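(* Suppose $\mathcal{X}=[0,1]^d$ is the $d$-dimensional unit cube and $X\sim\mathrm{Uniform}(\mathcal{X})$. Let $\Sigma^\alpha(L)$ denote the family of $(\alpha,L)$-H\''older continuous regression functions $\zeta:\mathcal{X}\to[0,1]$. Then there exist constants $n_0$ and $c>0$, depending only on $\alpha$, $L$ and $d$, such that, for all $n\ge n_0$ and any estimator $\hat\eta$, $$\sup_{\zeta\in\Sigma^\alpha(L)}\mathbb{P}\left[\|\eta-\hat\eta\|_\infty\ge c\left(\frac{\log(nr)}{n}\right)^{\frac{\alpha}{2\alpha+d}}r^{\frac{\alpha+d}{2\alpha+d}}\right]\ge\frac18,$$ where $\eta=r\zeta$.
   Context: Here $\alpha\in(0,1]$, $L>0$, and $r\in(0,1]$ is the class-imbalance parameter: the true regression function $\eta(x)=\mathbb{P}[Y=1\mid X=x]$ is written as $\eta=r\zeta$ with $\zeta:\mathcal{X}\to[0,1]$. The function $\zeta$ is $(\alpha,L)$-H\''older continuous if $|\zeta(x)-\zeta(x')|\le L\|x-x'\|_2^\alpha$ for all $x,x'\in\mathcal{X}$. Given $r$ and $\zeta$, the data $(X_1,Y_1),\dots,(X_n,Y_n)$ are i.i.d. with $X_i\sim\mathrm{Uniform}([0,1]^d)$, $Y_i\in\{0,1\}$ and $\mathbb{P}[Y_i=1\mid X_i=x]=\eta(x)=r\zeta(x)$; the probability in the claim is with respect to this sample. An estimator $\hat\eta$ is any (measurable) function of the sample taking values in functions $\mathcal{X}\to[0,1]$. $\|\eta-\hat\eta\|_\infty=\sup_{x\in\mathcal{X}}|\eta(x)-\hat\eta(x)|$.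 *)

(* Defs.v *)
From HB Require Import structures.
From mathcomp Require Import all_boot all_order all_algebra.
From mathcomp Require Import all_classical all_reals all_analysis.

Set Implicit Arguments.
Unset Strict Implicit.
Unset Printing Implicit Defensive.

Import Order.TTheory GRing.Theory Num.Theory.
Import numFieldNormedType.Exports.

Local Open Scope classical_set_scope.
Local Open Scope ring_scope.
Section iid_law.
Context (disp : measure_display) (T : measurableType disp) (R : realType).
Variable P : set T -> \bar R.

(* Law of [n] independent draws from [P]: the [n]-fold product of [P],
   transported to tuples with their product sigma-algebra. *)
Fixpoint iid_law (n : nat) : set (n.-tuple T) -> \bar R :=
  match n with
  | 0%N => \d_[tuple]
  | m.+1 => pushforward (P \x @iid_law m)%E
              (fun xt : T * m.-tuple T => [tuple of xt.1 :: xt.2])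
  end.

End iid_law.
Arguments iid_law {disp T R} P n _.

Section classification_model.
Context {R : realType} (d : nat).

(* Points of R^d are tuples because tuples carry the product of the Borel
   sigma-algebras of their coordinates. *)
Definition cube : set (d.-tuple R) :=
  [set x | forall i, 0 <= tnth x i <= 1].

Definition uniform_cube : set (d.-tuple R) -> \bar R :=
  iid_law (uniform_prob (@ltr01 R)) d.

Definition dist2 (x y : d.-tuple R) : R :=
  Num.sqrt (\sum_(i < d) (tnth x i - tnth y i) ^+ 2).

(* A function on [cube] is represented by a total function on R^d whose values
   outside [cube] are never used. *)
Definition holder (alpha L : R) : set (d.-tuple R -> R) :=
  [set zeta | {in cube, forall x, 0 <= zeta x <= 1} /\
              {in cube &, forall x y,
                 `|zeta x - zeta y| <= L * dist2 x y `^ alpha}].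

(* Joint law of (X, Y), with Y = [true] standing for Y = 1: X is uniform on
   [cube] and Y is Bernoulli(eta x) given X = x. *)
Definition observation_law (eta : d.-tuple R -> R) :
    set (d.-tuple R * bool) -> \bar R :=
  fun A => (\int[uniform_cube]_(x in cube)
              bernoulli_prob (eta x) (xsection A x))%E.

Definition sup_dist (f g : d.-tuple R -> R) : R :=
  sup [set `|f x - g x| | x in cube].

(* Measurability is with respect to the product sigma-algebra on [0,1]^cube,
   i.e. each evaluation of the estimator is a random variable. This is implied
   by joint measurability and by measurability for the sup-norm Borel sets. *)
Definition estimator (n : nat)
    (etahat : n.-tuple (d.-tuple R * bool) -> d.-tuple R -> R) : Prop :=
  (forall s, {in cube, forall x, 0 <= etahat s x <= 1}) /\
  {in cube, forall x, measurable_fun [set: n.-tuple (d.-tuple R * bool)]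
                                     (etahat ^~ x)}.

(* The sup norm is a supremum over uncountably many points, so an error event
   need not be measurable for an arbitrary [estimator]; its probability is read
   as the outer probability, which is the probability of the event whenever it
   is measurable (for the law or its completion). *)
Definition sample_prob (eta : d.-tuple R -> R) (n : nat) :
    set (n.-tuple (d.-tuple R * bool)) -> \bar R :=
  mu_ext (iid_law (observation_law eta) n).

End classification_model.

(* Main.v *)
Require Import Defs.
From HB Require Import structures.
From mathcomp Require Import all_boot all_order all_algebra.
From mathcomp Require Import all_classical all_reals all_analysis.
From mathcomp Require Import measurable_realfun giry ring lra.

Set Implicit Arguments.
Unset Strict Implicit.
Unset Printing Implicit Defensive.

Import Order.TTheory GRing.Theory Num.Theory.
Import numFieldNormedType.Exports.

Local Open Scope classical_set_scope.
Local Open Scope ring_scope.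

(** Write [N = n r] and let the grid size [m] be of order
    [(N / ln N) ^ (1 / (2 alpha + d))]. The constant function [1 / 2] is
    compared with [M = m ^ d] competitors, the [j]-th of which adds to [1 / 2]
    a tent of height [delta], of order [m ^ (- alpha)], supported by the [j]-th
    cell of the regular partition of the cube into [M] cells. At the centre of
    its cell the [j]-th regression function differs from the flat one by
    [r delta], which is of the order of the claimed rate. An estimator whose
    sup-norm error is below [r delta / 2] under each law would therefore tell
    from the sample whether a tent is present, and the point is that no test
    can do so reliably.

    Let [Lam j] be the likelihood ratio of the sample under the [j]-th
    competitor against the flat function. The cells are disjoint and likelihood
    ratios have conditional mean one, so [Lam i] and [Lam j] are exactly
    uncorrelated for [i != j] ([integral_perturb_lik2_disjoint]). The likelihood
    ratio of one observation has second moment at most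
    [1 + 4 r delta ^ 2 m ^ (- d)] ([integral_perturb_lik_sqr],
    [integral_tent_sqr]), so that of a sample has at most
    [exp (4 N delta ^ 2 m ^ (- d))], a small power of [N]; the grid size is
    chosen ([grid_size]) so that this is at most [2 M].

    Under these two facts a second moment computation on the average of the
    [Lam j] ([mixture_second_moment]) shows that an event of probability at
    most [1 / 8] under the flat law has probability at most [7 / 8] under some
    competitor. It is applied to the event [A] that the estimator is off by at
    least [r delta / 2] from the flat function at some cell centre. If [A] has
    probability above [1 / 8] under the flat law, the flat function is a
    witness; otherwise the complement of [A], on which the estimator is off from
    each competitor at the centre of its cell, has probability at least [1 / 8]
    under one of them ([bump_lower_bound]).

    Only values of the estimator at the finitely many centres are used, so the
    events are measurable, and they are contained in the sup-norm events, whose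
    probability is an outer one. *)

(** * Independent samples *)

(** A set function need only be shown to satisfy the axioms of a probability;
    the resulting structure has that very function as its underlying set
    function, so that rewriting between the two is by conversion. *)
Definition probability_of (d : measure_display) (T : measurableType d)
    (R : realType) (mu : set T -> \bar R) (mu0 : mu set0 = 0%E)
    (mu_ge0 : forall A, (0 <= mu A)%E) (mu_add : semi_sigma_additive mu)
    (muT : mu setT = 1%E) : probability T R :=
  let m : {measure set T -> \bar R} :=
    HB.pack mu (isMeasure.Build d T R mu mu0 mu_ge0 mu_add) in
  HB.pack mu (Measure.on m) (Measure_isProbability.Build d T R m muT).

Section iid_probability.
Context (disp : measure_display) (T : measurableType disp) (R : realType).
Local Open Scope ereal_scope.

Let consT (n : nat) (xt : T * n.-tuple T) : n.+1.-tuple T :=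
  [tuple of xt.1 :: xt.2].

Let measurable_consT n : measurable_fun [set: T * n.-tuple T] (@consT n).
Proof. exact: measurable_cons. Qed.

Lemma iid_law_probability (P : probability T R) (n : nat) :
  {Q : probability (n.-tuple T) R | iid_law P n = Q :> (set _ -> \bar R)}.
Proof.
elim: n => [|n [Q PQ]].
  by exists (\d_[tuple] : probability _ R).
have fT : pushforward (P \x Q) (@consT n) [set: n.+1.-tuple T] = 1.
  rewrite /pushforward preimage_setT -setXTT [LHS]product_measure1E//.
  by rewrite -[1]mule1; congr (_ * _); exact: probability_setT.
have mconsT := @measurable_consT n.
have push_add : semi_sigma_additive (pushforward (P \x Q) (@consT n)).
  exact: measure_semi_sigma_additive.
have push_ge0 A : 0 <= pushforward (P \x Q) (@consT n) A.
  by rewrite /pushforward; exact: integral_ge0.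
have push0 : pushforward (P \x Q) (@consT n) set0 = 0 by exact: measure0.
exists (probability_of push0 push_ge0 push_add fT).
by rewrite /= PQ.
Qed.

Definition iid_prob (P : probability T R) (n : nat) : probability _ R :=
  sval (iid_law_probability P n).

Lemma iid_lawE (P : probability T R) (n : nat) :
  iid_law P n = iid_prob P n :> (set _ -> \bar R).
Proof. by rewrite /iid_prob; case: iid_law_probability. Qed.

Lemma integral_iid_prob0 (P : probability T R) (f : 0.-tuple T -> \bar R) :
  (forall s, 0 <= f s) -> measurable_fun [set: 0.-tuple T] f ->
  \int[iid_prob P 0]_s f s = f [tuple].
Proof.
move=> f0 mf; rewrite -iid_lawE /=.
by rewrite integral_dirac// diracT mul1e.
Qed.

Lemma integral_iid_probS (P : probability T R) (n : nat)
    (f : n.+1.-tuple T -> \bar R) :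
  (forall s, 0 <= f s) -> measurable_fun [set: n.+1.-tuple T] f ->
  \int[iid_prob P n.+1]_s f s =
  \int[P]_x \int[iid_prob P n]_t f [tuple of x :: t].
Proof.
move=> f0 mf; rewrite -iid_lawE /= iid_lawE.
rewrite (ge0_integral_pushforward (@measurable_consT n))//.
rewrite preimage_setT fubini_tonelli1//.
- apply: measurableT_comp; [exact: mf|exact: measurable_consT].
- by move=> x; exact: f0.
Qed.

Let measurable_integral_cons (P : probability T R) (n : nat)
    (f : n.+1.-tuple T -> \bar R) :
  (forall s, 0 <= f s) -> measurable_fun [set: n.+1.-tuple T] f ->
  measurable_fun setT (fun x => \int[iid_prob P n]_t f [tuple of x :: t]).
Proof.
move=> f0 mf.
apply: (@measurable_fun_fubini_tonelli_F _ _ _ _ _ (iid_prob P n)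
  (fun xt => f [tuple of xt.1 :: xt.2])) => //.
by apply: measurableT_comp; [exact: mf|exact: measurable_consT].
Qed.

Lemma measurable_prod_tnth (n : nat) (g : 'I_n -> T -> R) :
  (forall i, measurable_fun setT (g i)) ->
  measurable_fun [set: n.-tuple T] (fun s => \prod_i g i (tnth s i))%R.
Proof.
move=> mg; apply: measurable_prod => i _.
by apply: measurableT_comp; [exact: mg|exact: measurable_tnth].
Qed.

Lemma integral_iid_prod (P : probability T R) (n : nat) (g : 'I_n -> T -> R)
    (q : 'I_n -> R) :
  (forall i x, 0 <= g i x)%R -> (forall i, measurable_fun setT (g i)) ->
  (forall i, \int[P]_x (g i x)%:E = (q i)%:E) ->
  \int[iid_prob P n]_s (\prod_i g i (tnth s i))%:E = (\prod_i q i)%:E.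
Proof.
elim: n g q => [|n IH] g q g0 mg gq.
  rewrite integral_iid_prob0 ?big_ord0//.
  - by move=> s; rewrite lee_fin prodr_ge0.
  - by apply/measurable_EFinP; exact: measurable_prod_tnth.
have prod_ge0 (t : n.-tuple T) :
    (0 <= \prod_(i < n) g (lift ord0 i) (tnth t i))%R by rewrite prodr_ge0.
rewrite integral_iid_probS; first last.
- by apply/measurable_EFinP; exact: measurable_prod_tnth.
- by move=> s; rewrite lee_fin prodr_ge0.
under eq_integral.
  move=> x _.
  under eq_integral.
    move=> t _; rewrite big_ord_recl tnth0.
    under eq_bigr do rewrite tnthS.
    rewrite EFinM.
    over.
  rewrite ge0_integralZl//; last 3 first.
  - apply/measurable_EFinP.
    exact: (@measurable_prod_tnth n (fun i => g (lift ord0 i))).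
  - by move=> t _; rewrite lee_fin.
  - by rewrite lee_fin.
  rewrite (IH (fun i => g (lift ord0 i)) (fun i => q (lift ord0 i)))//.
  over.
rewrite big_ord_recl EFinM -gq ge0_integralZr//.
- exact/measurable_EFinP.
- by move=> x _; rewrite lee_fin.
- rewrite lee_fin prodr_ge0// => i _; rewrite -lee_fin -gq.
  by apply: integral_ge0 => x _; rewrite lee_fin.
Qed.

Lemma measurable_box (n : nat) (I : 'I_n -> set T) :
  (forall i, measurable (I i)) ->
  measurable [set s : n.-tuple T | forall i, I i (tnth s i)].
Proof.
move=> mI.
rewrite (_ : [set s | _] = \bigcap_(i in [set: 'I_n])
    ((fun s : n.-tuple T => tnth s i) @^-1` I i)); last first.
  by apply/seteqP; split => s Is i /=; [move=> _|]; apply: Is.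
apply: fin_bigcap_measurable => // i _.
by rewrite -[X in measurable X]setTI; apply: (@measurable_tnth _ _ n i).
Qed.

Lemma iid_prob_box (P : probability T R) (n : nat) (I : 'I_n -> set T) :
  (forall i, measurable (I i)) ->
  iid_prob P n [set s | forall i, I i (tnth s i)] =
  (\prod_i fine (P (I i)))%:E.
Proof.
move=> mI.
have box_indic (s : n.-tuple T) : \1_[set t : n.-tuple T |
    forall i, I i (tnth t i)] s = (\prod_i \1_(I i) (tnth s i))%R :> R.
  rewrite indicE; have [/set_mem/= sI|sI] := boolP (s \in _).
    by rewrite big1// => i _; rewrite indicE mem_set.
  have [i iI] : exists i, ~ I i (tnth s i).
    by apply/existsNP => sI'; move/negP: sI; apply; rewrite inE.
  by rewrite (bigD1 i)//= indicE memNset// mul0r.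
rewrite -[X in iid_prob P n X]setIT -integral_indic//; last first.
  exact: measurable_box.
under eq_integral do rewrite box_indic.
apply: (integral_iid_prod (g := fun i => \1_(I i))) => //.
by move=> i; rewrite integral_indic// setIT fineK// fin_num_measure.
Qed.

(** By induction on the sample size: Fubini isolates the first draw, and the
    change of measure for one draw is applied to the integral over the other
    draws. This is why it is assumed for functions and not just for sets. *)
Lemma integral_iid_density (P Q : probability T R) (l : T -> R) (n : nat)
    (f : n.-tuple T -> \bar R) :
  (forall x, 0 <= l x)%R -> measurable_fun setT l ->
  (forall h : T -> \bar R, (forall x, 0 <= h x) -> measurable_fun setT h ->
     \int[Q]_x h x = \int[P]_x (h x * (l x)%:E)) ->
  (forall s, 0 <= f s) -> measurable_fun [set: n.-tuple T] f ->
  \int[iid_prob Q n]_s f s =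
  \int[iid_prob P n]_s (f s * (\prod_i l (tnth s i))%:E).
Proof.
move=> l0 ml PQ.
have prod_ge0 m (t : m.-tuple T) :
  (0 <= \prod_(i < m) l (tnth t i))%R by rewrite prodr_ge0.
have mfprod m (h : m.-tuple T -> \bar R) : measurable_fun [set: m.-tuple T] h ->
    measurable_fun [set: m.-tuple T]
      (fun s => h s * (\prod_i l (tnth s i))%:E).
  move=> mh; apply: emeasurable_funM => //; apply/measurable_EFinP.
  exact: (@measurable_prod_tnth _ (fun=> l)).
elim: n f => [|n IH] f f0 mf.
  rewrite !integral_iid_prob0 ?big_ord0 ?mule1//.
  - by move=> s; rewrite mule_ge0// lee_fin.
  - exact: mfprod.
rewrite !integral_iid_probS//; last 2 first.
- by move=> s; rewrite mule_ge0// lee_fin.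
- exact: mfprod.
have mfc x : measurable_fun [set: n.-tuple T] (fun t => f [tuple of x :: t]).
  apply: measurableT_comp; first exact: mf.
  exact: (@measurable_cons _ _ _ _ (fun=> x) n id).
rewrite PQ//; last 2 first.
- by move=> x; rewrite integral_ge0.
- exact: measurable_integral_cons.
apply: eq_integral => x _.
rewrite IH// -ge0_integralZr//; last 3 first.
- exact: mfprod.
- by move=> t _; rewrite mule_ge0// lee_fin.
- by rewrite lee_fin.
apply: eq_integral => t _.
rewrite big_ord_recl tnth0.
under [in RHS]eq_bigr do rewrite tnthS.
by rewrite EFinM -muleA (muleC (l x)%:E).
Qed.

End iid_probability.

(** * The uniform law on the cube and the law of one observation *)

Section observation_probability.
Context (R : realType) (d : nat).
Local Open Scope ereal_scope.

(** The one-dimensional uniform law lives on a copy of the line whose Borel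
    sigma-algebra has the same sets as that of R but another display. Its power
    is therefore restated as a probability on tuples of elements of R. *)
Let uniform_power := iid_prob (uniform_prob (@ltr01 R)) d.
Let U : set (d.-tuple R) -> \bar R := uniform_power.
Let U0 : U set0 = 0. Proof. exact: (@measure0 _ _ _ uniform_power). Qed.
Let U_ge0 A : 0 <= U A. Proof. exact: (@measure_ge0 _ _ _ uniform_power). Qed.
Let U_add : semi_sigma_additive U.
Proof. exact: (@measure_semi_sigma_additive _ _ _ uniform_power). Qed.
Let UT : U setT = 1. Proof. exact: (probability_setT uniform_power). Qed.

Definition cube_prob : probability (d.-tuple R) R :=
  probability_of U0 U_ge0 U_add UT.

Lemma uniform_cubeE : @uniform_cube R d = cube_prob :> (set _ -> \bar R).
Proof. exact: (iid_lawE (uniform_prob (@ltr01 R)) d). Qed.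

Lemma cube_prob_box (I : 'I_d -> set R) : (forall i, measurable (I i)) ->
  cube_prob [set x | forall i, I i (tnth x i)] =
  (\prod_i fine (uniform_prob (@ltr01 R) (I i)))%:E.
Proof. by move=> mI; exact: (iid_prob_box (uniform_prob (@ltr01 R)) mI). Qed.

Let unit_itv (_ : 'I_d) : set R := `[0%R, 1%R]%classic.

Let cube_box : @cube R d = [set x | forall i, unit_itv i (tnth x i)].
Proof.
by apply/seteqP; split => x xc i; have := xc i; rewrite /unit_itv /= in_itv.
Qed.

Lemma measurable_cube : measurable (@cube R d).
Proof.
by rewrite cube_box; apply: measurable_box => i; exact: measurable_itv.
Qed.

Lemma cube_prob1 : cube_prob (@cube R d) = 1.
Proof.
rewrite cube_box cube_prob_box; last by move=> i; exact: measurable_itv.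
rewrite big1// => i _.
by rewrite /uniform_prob integral_uniform_pdf1.
Qed.

Lemma integral_cube (h : d.-tuple R -> \bar R) :
  (forall x, 0 <= h x) -> measurable_fun setT h ->
  \int[cube_prob]_(x in @cube R d) h x = \int[cube_prob]_x h x.
Proof.
move=> h0 mh.
have mcube := measurable_cube.
rewrite [RHS](@ge0_negligible_integral _ _ _ _ _ (~` @cube R d))//.
- by rewrite setTD setCK.
- exact: measurableC.
- have := @probability_setC _ _ _ cube_prob _ mcube.
  by rewrite cube_prob1 subee.
Qed.

Section law.
Variable eta : d.-tuple R -> R.
Hypotheses (meta : measurable_fun setT eta).
Hypotheses (eta01 : forall x, (0 <= eta x <= 1)%R).

Let bern (x : d.-tuple R) (A : set (d.-tuple R * bool)) : \bar R :=
  bernoulli_prob (eta x) (xsection A x).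

Let bernE x A : bern x A =
  (eta x * \1_A (x, true) + (1 - eta x) * \1_A (x, false))%:E.
Proof.
rewrite /bern bernoulli_probE// !diracE !indicE.
by rewrite [RHS]EFinD !EFinM !mem_xsection.
Qed.

Let mbern A : measurable A -> measurable_fun setT (bern ^~ A).
Proof.
move=> mA; rewrite (_ : bern ^~ A = fun x =>
  (eta x * \1_A (x, true) + (1 - eta x) * \1_A (x, false))%:E); last first.
  by apply/funext => x; exact: bernE.
have m1 (b : bool) :
    measurable_fun setT (fun x : d.-tuple R => \1_A (x, b) : R).
  exact/(measurable_fun_pair1 b)/measurable_indic.
apply/measurable_EFinP; apply: measurable_funD; apply: measurable_funM => //.
exact: measurable_funB.
Qed.

Let observation_lawE A : measurable A ->
  observation_law eta A = \int[cube_prob]_x bern x A.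
Proof.
move=> mA; rewrite /observation_law uniform_cubeE integral_cube//.
exact: mbern.
Qed.

Let observation_law0 : observation_law eta set0 = 0.
Proof.
rewrite /observation_law uniform_cubeE; apply: integral0_eq => x _.
by rewrite xsection0.
Qed.

Let observation_law_ge0 A : 0 <= observation_law eta A.
Proof. by rewrite /observation_law uniform_cubeE; exact: integral_ge0. Qed.

Let observation_law_add : semi_sigma_additive (observation_law eta).
Proof.
move=> F mF tF mUF.
rewrite (_ : observation_law eta (\bigcup_n F n) =
    \sum_(i <oo) observation_law eta (F i)).
  by apply: is_cvg_nneseries => n _ _; exact: observation_law_ge0.
under eq_eseriesr do rewrite observation_lawE//.
rewrite observation_lawE// -integral_nneseries//; last first.
  by move=> n; exact: mbern.
apply: eq_integral => x _; rewrite /bern xsection_bigcup.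
by rewrite measure_semi_bigcup//; exact: trivIset_xsection.
Qed.

Let observation_lawT : observation_law eta setT = 1.
Proof.
rewrite observation_lawE// (eq_integral (cst 1)) ?integral_cst ?mul1e//.
by move=> x _; rewrite bernE !indicT !mulr1 addrC subrK.
Qed.

Definition observation_prob : probability (d.-tuple R * bool)%type R :=
  probability_of observation_law0 observation_law_ge0 observation_law_add
    observation_lawT.

Lemma sample_probE n :
  @sample_prob R d eta n = mu_ext (iid_prob observation_prob n).
Proof. by rewrite -iid_lawE. Qed.

(** On measurable sets the law of an observation is the mixture over [x] of the
    images of the Bernoulli laws under [pair x], that is, a bind in the Giry
    monad, which comes with an integration rule. *)
Lemma integral_observation_prob (g : d.-tuple R * bool -> \bar R) :
  (forall z, 0 <= g z) -> measurable_fun setT g ->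
  \int[observation_prob]_z g z =
  \int[cube_prob]_x ((eta x)%:E * g (x, true) + (1 - eta x)%:E * g (x, false)).
Proof.
move=> g0 mg.
have mpair (x : d.-tuple R) : measurable_fun [set: bool] (pair x) by [].
pose k x : giry (d.-tuple R * bool)%type R :=
  giry_map (mpair x) (bernoulli_prob (eta x)).
have kE x A : k x A = bern x A by rewrite /bern xsectionE.
have mk : measurable_fun setT k.
  apply: measurable_giry_codensity => // A mA.
  by under eq_fun do rewrite kE; exact: mbern.
have bindE A : measurable A -> observation_prob A = giry_bind cube_prob mk A.
  move=> mA; rewrite [LHS]observation_lawE//.
  transitivity (giry_int (giry_map mk cube_prob) (giry_ev ^~ A)) => //.
  rewrite giry_int_map//; first by apply: eq_integral => x _; rewrite -kE.
  exact: measurable_giry_ev.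
rewrite (eq_measure_integral (giry_bind cube_prob mk)); last first.
  by move=> A mA _; exact: bindE.
rewrite [LHS]giry_int_bind// {1}/giry_int; apply: eq_integral => x _.
rewrite giry_int_map// [LHS]integral_bernoulli_prob// => b; exact: g0.
Qed.

End law.

End observation_probability.

(** * The second moment bound for a mixture *)

(** The reason is the pointwise bound [1_A S <= M 1_A + S^2 / (4 M)] for the
    sum [S] of the [M] likelihood ratios: integrated against [Q0], the first
    term contributes [M Q0(A) <= M / 8], and the second, by near-orthogonality
    of the ratios, at most [(M^2 + 2 M^2) / (4 M) = 3 M / 4]. The average of the
    [Q j A] is thus at most [7 / 8]. *)
Lemma mixture_second_moment (d : measure_display) (S : measurableType d)
    (R : realType) (J : finType) (Q0 : probability S R)
    (Q : J -> probability S R) (Lam : J -> S -> R) (A : set S) :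
  (0 < #|J|)%N ->
  (forall j s, 0 <= Lam j s) -> (forall j, measurable_fun setT (Lam j)) ->
  (forall j B, measurable B ->
     Q j B = (\int[Q0]_s ((\1_B s)%:E * (Lam j s)%:E))%E) ->
  (forall i j, i != j -> (\int[Q0]_s (Lam i s * Lam j s)%:E <= 1)%E) ->
  (forall j, (\int[Q0]_s (Lam j s * Lam j s)%:E <= (2 * #|J|%:R)%:E)%E) ->
  measurable A -> (Q0 A <= 8^-1%:E)%E ->
  exists j, (Q j A <= (7 / 8)%:E)%E.
Proof.
move=> J0 L0 mL QL Lij Ljj mA Q0A.
set M : R := #|J|%:R.
have M0 : 0 < M by rewrite ltr0n.
have M0' := ltW M0.
pose T s := \sum_j Lam j s.
have mT : measurable_fun setT T by exact: measurable_sum.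
have T0 s : 0 <= T s by rewrite sumr_ge0.
have mI : measurable_fun setT (\1_A : S -> R) by exact: measurable_indic.
have mLL i j : measurable_fun setT (fun s => (Lam i s * Lam j s)%:E).
  by apply/measurable_EFinP; exact: measurable_funM.
have sumQ : (\sum_j Q j A = \int[Q0]_s ((\1_A s)%:E * (T s)%:E))%E.
  under eq_bigr do rewrite QL//.
  rewrite -ge0_integral_sum//.
  - apply: eq_integral => s _.
    by rewrite -ge0_sume_distrr ?sumEFin// => j _; rewrite lee_fin.
  - move=> j; apply/measurable_EFinP; exact: measurable_funM.
  - by move=> j s _; rewrite -EFinM lee_fin mulr_ge0.
have sqT : (\int[Q0]_s (T s * T s)%:E <= (3 * M * M)%:E)%E.
  have -> : (\int[Q0]_s (T s * T s)%:E =
      \sum_i \sum_j \int[Q0]_s (Lam i s * Lam j s)%:E)%E.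
    rewrite (eq_integral (fun s => \sum_i (\sum_j (Lam i s * Lam j s)%:E)%E)%E).
      rewrite ge0_integral_sum//; last 2 first.
      - by move=> i; exact: emeasurable_sum.
      - by move=> i s _; apply: sume_ge0 => j _; rewrite lee_fin mulr_ge0.
      apply: eq_bigr => i _; rewrite ge0_integral_sum// => j s _.
      by rewrite lee_fin mulr_ge0.
    move=> s _; rewrite /T mulr_suml -sumEFin; apply: eq_bigr => i _.
    by rewrite mulr_sumr -sumEFin.
  have rowT i : (\sum_j \int[Q0]_s (Lam i s * Lam j s)%:E <= (3 * M)%:E)%E.
    apply: (@le_trans _ _ (\sum_j (1 + (if j == i then 2 * M else 0))%:E)%E).
      apply: lee_sum => j _; have [->|ji] := eqVneq j i.
        by apply: (le_trans (Ljj i)); rewrite lee_fin lerDr.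
      by rewrite addr0 Lij// eq_sym.
    rewrite sumEFin lee_fin big_split/= -big_mkcond/= big_pred1_eq.
    by rewrite sumr_const -/M; lra.
  apply: (@le_trans _ _ (\sum_(i : J) (3 * M)%:E)%E).
    by apply: lee_sum => i _; exact: rowT.
  by rewrite sumEFin lee_fin sumr_const -[leLHS]mulr_natr.
have sumQ_le : (\sum_j Q j A <= (7 / 8 * M)%:E)%E.
  rewrite sumQ.
  apply: (@le_trans _ _ (\int[Q0]_s (M%:E * (\1_A s)%:E +
      (4 * M)^-1%:E * (T s * T s)%:E))%E).
    apply: ge0_le_integral => //.
    - by move=> s _; rewrite -EFinM lee_fin mulr_ge0.
    - by apply/measurable_EFinP; exact: measurable_funM.
    - apply/measurable_EFinP; apply: measurable_funD;
        apply: measurable_funM => //.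
      exact: measurable_funM.
    move=> s _; rewrite -!EFinM -EFinD lee_fin indicE.
    case: (s \in A); rewrite /= ?mul0r ?mul1r ?mulr0 ?mulr1 ?add0r.
      (* (T - 2 M)^2 >= 0 *)
      rewrite -subr_ge0.
      have -> : M + (4 * M)^-1 * (T s * T s) - T s =
          (4 * M)^-1 * (T s - 2 * M) ^+ 2 by field; rewrite gt_eqF.
      by rewrite mulr_ge0 ?sqr_ge0// invr_ge0; lra.
    by rewrite mulr_ge0 ?mulr_ge0// invr_ge0; lra.
  rewrite ge0_integralD//; last 4 first.
  - by move=> s _; rewrite -EFinM lee_fin mulr_ge0.
  - by apply/measurable_EFinP; exact: measurable_funM.
  - by move=> s _; rewrite -EFinM lee_fin !mulr_ge0// invr_ge0; lra.
  - apply/measurable_EFinP; apply: measurable_funM => //.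
    exact: measurable_funM.
  rewrite ge0_integralZl//; last first.
    exact/measurable_EFinP.
  rewrite ge0_integralZl//; last 3 first.
  - by apply/measurable_EFinP; exact: measurable_funM.
  - by move=> s _; rewrite lee_fin mulr_ge0.
  - by rewrite lee_fin invr_ge0; lra.
  rewrite integral_indic// setIT.
  apply: (@le_trans _ _ (M%:E * 8^-1%:E + (4 * M)^-1%:E * (3 * M * M)%:E)%E).
    by rewrite leeD// lee_wpmul2l// lee_fin ?ltW// invr_gt0; lra.
  rewrite -!EFinM -EFinD lee_fin le_eqVlt; apply/orP; left; apply/eqP.
  by field; rewrite gt_eqF.
apply/not_existsP => Qgt.
have QE j : Q j A = (fine (Q j A))%:E by rewrite fineK// fin_num_measure.
have : (\sum_(j : J) (7 / 8) < \sum_j fine (Q j A))%R.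
  apply: ltr_sum => [|j _].
    by case/card_gt0P: J0 => j _; apply/hasP; exists j; rewrite ?mem_index_enum.
  by rewrite -lte_fin -QE ltNge; apply/negP; exact: Qgt.
rewrite ltNge sumr_const -[leRHS]mulr_natr -lee_fin -sumEFin -/M.
by under eq_bigr do rewrite -QE; rewrite sumQ_le.
Qed.

(** * Tents on a regular grid of the cube *)

Section tents.
Context (R : realType) (d : nat).
Implicit Types (x y c : d.-tuple R) (m : nat).

(** The sup distance: its balls are boxes, whose measure is a product, and it is
    dominated by the Euclidean distance. *)
Definition max_dist x y : R :=
  \big[Num.max/0]_(i < d) `|tnth x i - tnth y i|.

Lemma max_dist_ge0 x y : 0 <= max_dist x y.
Proof. exact: bigmax_ge_id. Qed.

Lemma le_max_dist x y i : `|tnth x i - tnth y i| <= max_dist x y.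
Proof. exact: (le_bigmax _ (fun i => `|tnth x i - tnth y i|)). Qed.

Lemma max_distxx x : max_dist x x = 0.
Proof.
apply/eqP; rewrite eq_le max_dist_ge0 andbT.
by apply/bigmax_leP; split=> // i _; rewrite subrr normr0.
Qed.

Lemma dist2_ge0 x y : 0 <= dist2 x y. Proof. exact: sqrtr_ge0. Qed.

Lemma dist2C x y : dist2 x y = dist2 y x.
Proof.
by congr Num.sqrt; apply: eq_bigr => i _; rewrite -opprB sqrrN.
Qed.

Lemma coord_le_dist2 x y i : `|tnth x i - tnth y i| <= dist2 x y.
Proof.
rewrite -sqrtr_sqr ler_wsqrtr// (bigD1 i)//= lerDl sumr_ge0// => k _.
exact: sqr_ge0.
Qed.

Lemma max_dist_lipschitz x y c : `|max_dist x c - max_dist y c| <= dist2 x y.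
Proof.
have half (a b : d.-tuple R) : max_dist a c <= dist2 a b + max_dist b c.
  apply/bigmax_leP; split=> [|i _].
    by rewrite addr_ge0 ?dist2_ge0 ?max_dist_ge0.
  rewrite (le_trans (ler_distD (tnth b i) _ _))//.
  by rewrite lerD ?coord_le_dist2 ?le_max_dist.
rewrite ler_norml; apply/andP; split.
  by rewrite lerBrDr addrC lerBlDr (le_trans (half y x))// dist2C addrC.
by rewrite lerBlDr half.
Qed.

Lemma measurable_max_dist c : measurable_fun setT (max_dist ^~ c).
Proof.
rewrite /max_dist; elim: (index_enum _) => [|i s IH].
  by under eq_fun do rewrite big_nil; exact: measurable_cst.
under eq_fun do rewrite big_cons.
apply: measurable_maxr => //; apply: measurableT_comp => //.
by apply: measurable_funB => //; exact: measurable_tnth.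
Qed.

(** The slope [2 m] makes the support the cell of side [1 / m] around [c]. *)
Definition tent m c x : R := Num.max 0 (1 - 2 * m%:R * max_dist x c).

Lemma tent_ge0 m c x : 0 <= tent m c x.
Proof. by rewrite le_max lexx. Qed.

Lemma tent_le1 m c x : tent m c x <= 1.
Proof.
by rewrite ge_max ler01/= lerBlDr lerDl !mulr_ge0// max_dist_ge0.
Qed.

Lemma tent_center m c : tent m c c = 1.
Proof. by rewrite /tent max_distxx mulr0 subr0 max_r. Qed.

Lemma measurable_tent m c : measurable_fun setT (tent m c).
Proof.
apply: measurable_maxr => //; apply: measurable_funB => //.
by apply: measurable_funM => //; exact: measurable_max_dist.
Qed.

(** Being both 1-bounded and Lipschitz, a tent is Hölder of every exponent in
    (0, 1], since [min 1 t <= t `^ alpha] for nonnegative [t]. *)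
Lemma tent_holder m c x y (alpha : R) : 0 < alpha -> alpha <= 1 ->
  `|tent m c x - tent m c y| <= (2 * m%:R * dist2 x y) `^ alpha.
Proof.
move=> a0 a1; set t := 2 * m%:R * dist2 x y.
have t0 : 0 <= t by rewrite !mulr_ge0 ?dist2_ge0.
have lip : `|tent m c x - tent m c y| <= t.
  have maxr_lip (u v : R) : `|Num.max 0 u - Num.max 0 v| <= `|u - v|.
    rewrite !maxEle; case: (leP 0 u) => u0; case: (leP 0 v) => v0;
      rewrite ?subrr ?normr0 ?subr0 ?sub0r ?normrN//.
    - by rewrite !ger0_norm ?subr_ge0; lra.
    - rewrite ger0_norm// distrC ger0_norm; lra.
  apply: (le_trans (maxr_lip _ _)).
  rewrite [X in `|X|](_ : _ = 2 * m%:R * (max_dist y c - max_dist x c));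
    last by ring.
  rewrite normrM ger0_norm ?mulr_ge0// ler_wpM2l ?mulr_ge0//.
  by rewrite dist2C max_dist_lipschitz.
have [t1|t1] := leP t 1.
  apply: (le_trans lip); have [->|tn0] := eqVneq t 0; first exact: powR_ge0.
  by rewrite -[leLHS]powRr1// ger_powR// lt_neqAle eq_sym tn0 t0.
apply: (@le_trans _ _ 1).
  rewrite ler_norml; have := tent_ge0 m c x; have := tent_ge0 m c y.
  by have := tent_le1 m c x; have := tent_le1 m c y; lra.
by rewrite -[leLHS](powRr0 t) ler_powR// ltW.
Qed.

Lemma tent_support m c x : (0 < m)%N -> tent m c x != 0 ->
  forall i, `|tnth x i - tnth c i| < (2 * m%:R)^-1.
Proof.
move=> m0 tx i.
have {tx} : 0 < 1 - 2 * m%:R * max_dist x c.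
  rewrite ltNge; apply: contra tx => h; rewrite /tent max_l//.
rewrite subr_gt0 mulrC -ltr_pdivlMr ?mulr_gt0 ?ltr0n// mul1r.
exact: le_lt_trans (le_max_dist x c i).
Qed.

Definition grid_center m (j : {ffun 'I_d -> 'I_m}) : d.-tuple R :=
  [tuple (2 * (j i)%:R + 1) / (2 * m%:R) | i < d].

Lemma grid_center_cube m (j : {ffun 'I_d -> 'I_m}) : cube (grid_center j).
Proof.
move=> i; rewrite tnth_mktuple.
have m0 : 0 < m%:R :> R by rewrite ltr0n (leq_trans _ (ltn_ord (j i))).
have jm : (j i)%:R + 1 <= m%:R :> R by rewrite natr1 ler_nat.
have j0 : 0 <= (j i)%:R :> R by [].
by rewrite divr_ge0 ?ler_pdivrMr/=; lra.
Qed.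

(** Distinct centres are at sup distance at least [1 / m], twice the radius of
    the support of a tent. *)
Lemma tent_disjoint m (j k : {ffun 'I_d -> 'I_m}) x : j != k ->
  tent m (grid_center j) x * tent m (grid_center k) x = 0.
Proof.
move=> jk; have [i jki] : exists i, j i != k i.
  apply/existsP; apply: contraNT jk; rewrite negb_exists => /forallP h.
  by apply/eqP/ffunP => i; apply/eqP; have := h i; rewrite negbK.
have m0 : (0 < m)%N by rewrite (leq_trans _ (ltn_ord (j i))).
have m0' : 0 < m%:R :> R by rewrite ltr0n.
apply/eqP; rewrite mulf_eq0; apply/negPn; rewrite negb_or.
apply/negP => /andP[tj tk].
have /(_ i) := tent_support m0 tj; have /(_ i) := tent_support m0 tk.
rewrite !tnth_mktuple => xk xj.
have : `|(2 * (j i)%:R + 1) / (2 * m%:R) - (2 * (k i)%:R + 1) / (2 * m%:R)| <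
    (m%:R)^-1 :> R.
  apply: (le_lt_trans (ler_distD (tnth x i) _ _)); rewrite distrC.
  have -> : m%:R^-1 = (2 * m%:R)^-1 + (2 * m%:R)^-1 :> R.
    by field; rewrite gt_eqF.
  exact: ltrD.
have -> : (2 * (j i)%:R + 1) / (2 * m%:R) - (2 * (k i)%:R + 1) / (2 * m%:R) =
    ((j i)%:R - (k i)%:R) / m%:R :> R by field; rewrite gt_eqF.
rewrite normrM normfV (ger0_norm (ltW m0')) ltr_pdivrMr// mulVf ?gt_eqF//.
have : (j i)%:R + 1 <= (k i)%:R :> R \/ (k i)%:R + 1 <= (j i)%:R :> R.
  rewrite !natr1 !ler_nat.
  case: (ltngtP (j i) (k i)) => [| |jk']; [by left|by right|].
  by case/eqP: jki; exact: val_inj.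
by case=> h; apply/negP; rewrite -leNgt ler_normr; apply/orP; [right|left]; lra.
Qed.

Lemma uniform_prob_itv (a b : R) : a < b ->
  (uniform_prob (@ltr01 R) `]a, b[ <= (b - a)%:E)%E.
Proof.
move=> ab.
rewrite (_ : (b - a)%:E = \int[lebesgue_measure]_(x in `]a, b[) (cst 1%E x))%E.
  apply: ge0_le_integral => //.
  - by move=> x _; rewrite lee_fin uniform_pdf_ge0.
  - apply/measurable_EFinP/measurable_funTS; exact: measurable_uniform_pdf.
  - move=> x _; rewrite lee_fin /uniform_pdf subr0 invr1.
    by case: ifP.
by rewrite integral_cst//= mul1e lebesgue_measure_itv/= lte_fin ab.
Qed.

(** The square of a tent is at most the indicator of its support, a box of
    side [1 / m]. *)
Lemma integral_tent_sqr m c : (0 < m)%N ->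
  (\int[cube_prob R d]_x (tent m c x ^+ 2)%:E <= (m%:R^-1 ^+ d)%:E)%E.
Proof.
move=> m0.
have m0' : 0 < m%:R :> R by rewrite ltr0n.
pose I i : set R :=
  `]tnth c i - (2 * m%:R)^-1, tnth c i + (2 * m%:R)^-1[%classic.
have mI i : measurable (I i) by exact: measurable_itv.
pose B := [set y : d.-tuple R | forall i, I i (tnth y i)].
have mB : measurable B by exact: measurable_box.
apply: (@le_trans _ _ (\int[cube_prob R d]_x (\1_B x)%:E)%E).
  apply: ge0_le_integral => //.
  - by move=> x _; rewrite lee_fin sqr_ge0.
  - apply/measurable_EFinP; apply: measurable_funX; exact: measurable_tent.
  - apply/measurable_EFinP; exact: measurable_indic.
  move=> x _; rewrite lee_fin indicE.
  have [->|tx] := eqVneq (tent m c x) 0; first by rewrite expr0n/=.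
  rewrite mem_set/= ?exprn_ile1 ?tent_ge0 ?tent_le1// => i.
  by rewrite /I/= in_itv/= -ltr_distl tent_support.
rewrite integral_indic// setIT [leLHS](cube_prob_box mI) lee_fin.
rewrite -[X in _ ^+ X]card_ord -prodr_const; apply: ler_prod => i _.
rewrite fine_ge0//= -lee_fin fineK; last first.
  by rewrite fin_num_measure//; exact: mI.
apply: (le_trans (uniform_prob_itv _)).
  by rewrite ltrBlDr -addrA ltrDl addr_gt0// invr_gt0 mulr_gt0.
by rewrite lee_fin le_eqVlt; apply/orP; left; apply/eqP; field; rewrite gt_eqF.
Qed.

End tents.
Arguments grid_center {R d m} j.

(** * Likelihood ratios of a perturbed constant regression function *)

Section perturbation.
Context (R : realType) (d : nat) (r : R).
Hypotheses (r0 : 0 < r) (r1 : r <= 1).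
Implicit Types (u v : d.-tuple R -> R).

Definition perturb u (x : d.-tuple R) : R := r * (2^-1 + u x).

(** The density of the law with regression function [perturb u] with respect to
    the law with constant regression function [r / 2]: the ratio of the
    probabilities of the observed label. *)
Definition perturb_lik u (z : d.-tuple R * bool) : R :=
  if z.2 then 1 + 2 * u z.1 else 1 - r * u z.1 / (1 - r / 2).

Definition half_range u := measurable_fun setT u /\ forall x, 0 <= u x <= 2^-1.

Let half0 : 0 < 1 - r / 2. Proof. by have [? ?] := (r0, r1); lra. Qed.

Let two_r : 2 - r != 0.
Proof. by have [? ?] := (r0, r1); rewrite gt_eqF//; lra. Qed.

Lemma half_range0 : half_range (cst 0).
Proof. by split => //= x; rewrite lexx/= invr_ge0. Qed.

Lemma measurable_perturb u : half_range u -> measurable_fun setT (perturb u).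
Proof.
by case=> mu _; apply: measurable_funM => //; exact: measurable_funD.
Qed.

Lemma perturb01 u : half_range u -> forall x, 0 <= perturb u x <= 1.
Proof.
case=> _ u01 x; have /andP[u0 u1] := u01 x; rewrite /perturb.
have [? ?] := (r0, r1).
by apply/andP; split; nra.
Qed.

Definition perturb_prob u (hu : half_range u) :
    probability (d.-tuple R * bool)%type R :=
  observation_prob (measurable_perturb hu) (perturb01 hu).

Lemma sample_prob_perturb u (hu : half_range u) (n : nat) :
  @sample_prob R d (perturb u) n = mu_ext (iid_prob (perturb_prob hu) n).
Proof. exact: sample_probE. Qed.

Lemma perturb_lik_ge0 u : half_range u -> forall z, 0 <= perturb_lik u z.
Proof.
case=> _ u01 [x b]; have /andP[u0 u1] := u01 x; rewrite /perturb_lik /=.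
case: b; first lra.
by have [? ?] := (r0, r1); rewrite subr_ge0 ler_pdivrMr//; nra.
Qed.

Lemma measurable_perturb_lik u : half_range u ->
  measurable_fun setT (perturb_lik u).
Proof.
case=> mu _.
have mu1 : measurable_fun setT (fun z : d.-tuple R * bool => u z.1).
  exact: measurableT_comp.
apply: measurable_fun_ifT => //.
  by apply: measurable_funD => //; exact: measurable_funM.
apply: measurable_funB => //; apply: measurable_funM => //.
exact: measurable_funM.
Qed.

Lemma integral_perturb_density u (hu : half_range u)
    (h : d.-tuple R * bool -> \bar R) :
  (forall z, 0 <= h z)%E -> measurable_fun setT h ->
  (\int[perturb_prob hu]_z h z =
   \int[perturb_prob half_range0]_z (h z * (perturb_lik u z)%:E))%E.
Proof.
move=> h0 mh.
have l0 := perturb_lik_ge0 hu.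
rewrite !integral_observation_prob//; last 2 first.
- by move=> z; rewrite mule_ge0// lee_fin.
- apply: emeasurable_funM => //; apply/measurable_EFinP.
  exact: measurable_perturb_lik.
apply: eq_integral => x _; rewrite /perturb_lik/= /perturb addr0.
rewrite ![(h _ * _)%E]muleC !muleA -!EFinM.
by congr (_%:E * _ + _%:E * _)%E; field; rewrite ?two_r.
Qed.

(** Conditionally on [x], the two likelihood ratios have mean one under the
    unperturbed law, so only the product of the perturbations survives. *)
Lemma integral_perturb_lik2 u v : half_range u -> half_range v ->
  (\int[perturb_prob half_range0]_z (perturb_lik u z * perturb_lik v z)%:E =
   \int[cube_prob R d]_x
     (1 + (2 * r + r ^+ 2 / (1 - r / 2)) * (u x * v x))%:E)%E.
Proof.
move=> hu hv.
rewrite integral_observation_prob; last 2 first.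
- by move=> z; rewrite lee_fin mulr_ge0// perturb_lik_ge0.
- by apply/measurable_EFinP; apply: measurable_funM;
    exact: measurable_perturb_lik.
apply: eq_integral => x _; rewrite /perturb_lik/= /perturb addr0.
by rewrite -!EFinM -EFinD; congr (_%:E); field; rewrite ?two_r.
Qed.

Lemma integral_perturb_lik2_disjoint u v : half_range u -> half_range v ->
  (forall x, u x * v x = 0) ->
  (\int[perturb_prob half_range0]_z
     (perturb_lik u z * perturb_lik v z)%:E = 1)%E.
Proof.
move=> hu hv uv0; rewrite integral_perturb_lik2//.
under eq_integral do rewrite uv0 mulr0 addr0.
by rewrite integral_cst// mul1e; exact: (probability_setT (cube_prob R d)).
Qed.

Lemma integral_perturb_lik_sqr u (s : R) : half_range u ->
  (\int[cube_prob R d]_x (u x ^+ 2)%:E <= s%:E)%E ->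
  (\int[perturb_prob half_range0]_z (perturb_lik u z * perturb_lik u z)%:E <=
    (1 + 4 * r * s)%:E)%E.
Proof.
move=> hu us; rewrite integral_perturb_lik2//.
have [? ?] := (r0, r1).
have mu2 : measurable_fun setT (fun x => u x ^+ 2).
  by apply: measurable_funX; case: hu.
apply: (@le_trans _ _
    (\int[cube_prob R d]_x (1 + (4 * r)%:E * (u x ^+ 2)%:E))%E).
  apply: ge0_le_integral => //.
  - move=> x _; rewrite lee_fin addr_ge0// mulr_ge0//; last first.
      by rewrite -expr2 sqr_ge0.
    by rewrite addr_ge0 ?divr_ge0 ?sqr_ge0//; lra.
  - apply/measurable_EFinP; apply: measurable_funD => //.
    exact: measurable_funM.
  - apply: emeasurable_funD => //; apply/measurable_EFinP.
    exact: measurable_funM.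
  move=> x _; rewrite -EFinM -EFinD lee_fin lerD2l -expr2 ler_wpM2r ?sqr_ge0//.
  (* 1 - r / 2 >= 1 / 2 *)
  by rewrite -lerBrDl ler_pdivrMr//; nra.
rewrite ge0_integralD//; last 2 first.
- by move=> x _; rewrite -EFinM lee_fin mulr_ge0 ?sqr_ge0//; lra.
- by apply/measurable_EFinP; exact: measurable_funM.
rewrite integral_cst// mul1e ge0_integralZl//; last 3 first.
- exact/measurable_EFinP.
- by move=> x _; rewrite lee_fin sqr_ge0.
- by rewrite lee_fin; lra.
rewrite EFinD [(4 * r * s)%:E]EFinM; apply: leeD.
  by rewrite [leLHS](probability_setT (cube_prob R d)).
by apply: lee_wpmul2l => //; rewrite lee_fin; lra.
Qed.

End perturbation.

(** * Choice of the grid size *)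

(** Take [t = (N / ln N) ^ (1 / beta)] rounded up. From [m >= t] one gets
    [N m ^ (- beta) <= ln N], so the left-hand side of the second claim is at
    most [N ^ (4 / 25)], whereas [m ^ d >= t ^ d] is at least
    [N ^ (d / (2 beta))], and [d / (2 beta) >= 1 / 6] because [beta <= 3 d].
    The third claim comes from [m <= 2 t]. When [N = 1], [t] is infinite, but
    then the rate vanishes and [m = 1] works thanks to the factor [2]. *)
Lemma grid_size (R : realType) (d : nat) (alpha N : R)
    (beta := 2 * alpha + d%:R) :
  (0 < d)%N -> 0 < alpha -> alpha <= 1 -> 1 <= N ->
  exists m : nat, [/\ (0 < m)%N,
    expR (4 / 25 * (N * m%:R `^ (- beta))) <= 2 * m%:R ^+ d &
    (ln N / N) `^ (alpha / beta) <= (2 / m%:R) `^ alpha].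
Proof.
move=> d0 a0 a1 N1.
have d1 : 1 <= d%:R :> R by rewrite ler1n.
have b0 : 0 < beta by rewrite /beta; lra.
have powE (x p : R) : 0 < x -> x `^ p = expR (p * ln x).
  by move=> x0; rewrite /powR gt_eqF.
have [->|N1'] := eqVneq N 1.
  exists 1%N; split => //.
    rewrite powR1 mulr1 expr1n !mulr1.
    have := expR_ge1Dx (- (4 / 25) : R).
    have := expR_gt0 (4 / 25 : R); rewrite expRN => e0 he.
    have : (1 + - (4 / 25)) * expR (4 / 25 : R) <= 1.
      by rewrite -ler_pdivlMr// div1r.
    lra.
  by rewrite ln1 mul0r powR0 ?powR_ge0// gt_eqF// divr_gt0.
have N0 : 0 < N by lra.
have lnN0 : 0 < ln N by rewrite ln_gt0// lt_neqAle eq_sym N1'.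
(* ln x = ln (x / 2) + ln 2 <= (x / 2 - 1) + 1 *)
have lnln : ln (ln N) <= ln N / 2.
  have -> : ln (ln N) = ln (1 + (ln N / 2 - 1)) + ln (1 + 1).
    by rewrite -lnM ?posrE//; [congr ln; field|lra].
  have h1 : ln (1 + (ln N / 2 - 1)) <= ln N / 2 - 1 by apply: le_ln1Dx; lra.
  have h2 : ln (1 + 1) <= 1 :> R by apply: le_ln1Dx; lra.
  lra.
pose W := ln N - ln (ln N).
pose t := expR (W / beta).
have W0 : 0 <= W / beta.
  rewrite divr_ge0 ?(ltW b0)// /W; lra.
have t1 : 1 <= t by rewrite -expR0 ler_expR.
have /andP[mt tm] := truncn_itv (le_trans ler01 t1).
pose m := (Num.truncn t).+1.
have m0 : 0 < m%:R :> R by rewrite ltr0n.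
have m2t : m%:R <= 2 * t by rewrite /m -natr1; lra.
have lnm_ge : W / beta <= ln m%:R.
  by rewrite -[leLHS]expRK ler_ln ?posrE ?expR_gt0// ltW.
have lnm_le : ln m%:R <= ln 2 + W / beta.
  rewrite -[W / beta]expRK -lnM ?posrE ?expR_gt0// ler_ln ?posrE//.
  by rewrite mulr_gt0// expR_gt0.
exists m; split => //.
  have Nm : N * m%:R `^ (- beta) <= ln N.
    rewrite powE// -[X in X * _](lnK N0) -expRD -[leRHS](lnK lnN0) ler_expR.
    have : W <= beta * ln m%:R by rewrite mulrC -ler_pdivrMr.
    by rewrite /W; lra.
  have md : m%:R ^+ d = expR (d%:R * ln m%:R) :> R.
    by rewrite expRM_natl lnK.
  apply: (@le_trans _ _ (m%:R ^+ d)); last first.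
    by rewrite ler_peMl ?exprn_ge0 ?(ltW m0) ?ler1n.
  rewrite md ler_expR.
  apply: (@le_trans _ _ (4 / 25 * ln N)); first by rewrite ler_pM2l.
  apply: (@le_trans _ _ (d%:R * (W / beta))); last by rewrite ler_pM2l// ltr0n.
  rewrite mulrA ler_pdivlMr//.
  have : ln N / 2 <= W by rewrite /W; lra.
  have : beta <= 3 * d%:R by rewrite /beta; lra.
  nra.
have -> : (ln N / N) `^ (alpha / beta) = expR (alpha * - (W / beta)).
  rewrite powE ?divr_gt0// lnM ?posrE ?invr_gt0// lnV ?posrE// /W.
  by congr expR; ring.
rewrite powE ?divr_gt0// lnM ?posrE ?invr_gt0// lnV ?posrE//.
by rewrite ler_expR ler_pM2l//; lra.
Qed.

(** * The lower bound *)

Lemma le_mu_ext_measurable (disp : measure_display) (T : measurableType disp)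
    (R : realType) (mu : {measure set T -> \bar R}) (B C : set T) :
  measurable B -> B `<=` C -> (mu B <= mu_ext mu C)%E.
Proof.
by move=> mB BC; rewrite -(measurable_mu_extE mu mB); exact: le_mu_ext.
Qed.

Lemma sup_dist_ge (R : realType) (d : nat) (f g : d.-tuple R -> R)
    (x : d.-tuple R) :
  {in @cube R d, forall y, 0 <= f y <= 1} ->
  {in @cube R d, forall y, 0 <= g y <= 1} ->
  cube x -> `|f x - g x| <= sup_dist f g.
Proof.
move=> f01 g01 cx; apply: ub_le_sup; last by exists x.
exists 1 => _ [y cy <-].
have := f01 y (mem_set cy); have := g01 y (mem_set cy).
by rewrite ler_norml; lra.
Qed.

Lemma measurable_deviation (R : realType) (d n : nat)
    (etahat : n.-tuple (d.-tuple R * bool) -> d.-tuple R -> R) (tau v : R)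
    (x : d.-tuple R) :
  estimator etahat -> cube x ->
  measurable [set s | tau <= `|v - etahat s x|].
Proof.
case=> _ meta cx.
have mdev : measurable_fun [set: n.-tuple (d.-tuple R * bool)]
    (fun s => `|v - etahat s x|).
  apply: measurableT_comp => //; apply: measurable_funB => //.
  by apply: meta; rewrite inE.
rewrite (_ : [set s | _] = (fun s => `|v - etahat s x|) @^-1` `[tau, +oo[).
  rewrite -[X in measurable X]setTI.
  by apply: mdev => //; exact: measurable_itv.
by apply/seteqP; split => s /=; rewrite in_itv/= andbT.
Qed.

Section bumps.
Context (R : realType) (d : nat) (alpha L r a : R) (n m : nat).
Hypotheses (alpha0 : 0 < alpha) (alpha1 : alpha <= 1).
Hypotheses (r0 : 0 < r) (r1 : r <= 1).
Hypotheses (a0 : 0 < a) (aL : a <= L) (a5 : a <= 5^-1) (m0 : (0 < m)%N).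

(** The exponent and the scale [2 m] are those of the Hölder bound for a tent,
    so that [a <= L] makes the bumps Hölder. The bound [a <= 1 / 5] keeps their
    height small enough for the second moment of the likelihood ratios. *)
Let delta := a * (2 * m%:R) `^ (- alpha).
Let bump (j : {ffun 'I_d -> 'I_m}) (x : d.-tuple R) : R :=
  delta * tent m (grid_center j) x.

Let m1 : 1 <= m%:R :> R. Proof. by rewrite ler1n. Qed.

Let delta_gt0 : 0 < delta.
Proof. by rewrite mulr_gt0// powR_gt0// mulr_gt0// (lt_le_trans ltr01). Qed.

Let delta_le : delta <= 5^-1 * m%:R `^ (- alpha).
Proof.
rewrite ler_pM// ?powR_ge0 ?(ltW a0)// !powRN lef_pV2 ?posrE ?powR_gt0 ?ltr0n//.
  by apply: ge0_ler_powR; rewrite ?nnegrE ?(ltW alpha0)//; have := m1; lra.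
by rewrite mulr_gt0// ltr0n.
Qed.

Let half_range_bump j : half_range (bump j).
Proof.
split=> [|x]; first by apply: measurable_funM => //; exact: measurable_tent.
have t0 := tent_ge0 m (grid_center j) x.
have t1 := tent_le1 m (grid_center j) x.
have d0 := delta_gt0.
have d1 : delta <= 5^-1.
  apply: (le_trans delta_le).
  rewrite ler_piMr// powRN invf_le1 ?powR_gt0 ?ltr0n//.
  by rewrite -[leLHS](powRr0 m%:R) ler_powR ?m1 ?(ltW alpha0).
by rewrite /bump; apply/andP; split; nra.
Qed.

Let holder_bump j : holder alpha L (fun x => 2^-1 + bump j x).
Proof.
split=> [x _|x y _ _].
  by have /andP[] := (half_range_bump j).2 x; lra.
rewrite opprD addrACA subrr add0r -mulrBr normrM (gtr0_norm delta_gt0).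
apply: (@le_trans _ _ (delta * (2 * m%:R * dist2 x y) `^ alpha)).
  by rewrite ler_pM2l// tent_holder.
rewrite powRM ?mulr_ge0 ?dist2_ge0// mulrA ler_wpM2r ?powR_ge0//.
rewrite /delta powRN -mulrA mulVf ?mulr1//.
by rewrite gt_eqF// powR_gt0// mulr_gt0// ltr0n.
Qed.

Let holder_flat : holder alpha L (fun _ : d.-tuple R => 2^-1 + 0).
Proof.
split=> [x _|x y _ _]; first lra.
by rewrite subrr normr0 mulr_ge0 ?powR_ge0// (le_trans (ltW a0)).
Qed.

(** Up to the factor [2], the second moment of the likelihood ratio of a sample
    is at most the number of cells. *)
Hypothesis cost : expR (4 / 25 * (n%:R * r * m%:R `^ (- (2 * alpha + d%:R)))) <=
  2 * m%:R ^+ d.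

Let lik j := perturb_lik r (bump j).

Let sample_lik j (s : n.-tuple (d.-tuple R * bool)) : R :=
  \prod_i lik j (tnth s i).

Let flat_prob := perturb_prob r0 r1 (@half_range0 R d).

Let bump_prob j := perturb_prob r0 r1 (half_range_bump j).

Let integral_sample_lik2 i j (q : R) :
  (\int[flat_prob]_z (lik i z * lik j z)%:E = q%:E)%E ->
  (\int[iid_prob flat_prob n]_s (sample_lik i s * sample_lik j s)%:E =
   (q ^+ n)%:E)%E.
Proof.
move=> hq.
under eq_integral do rewrite /sample_lik -big_split/=.
rewrite (integral_iid_prod (g := fun _ z => lik i z * lik j z)
  (q := fun=> q))//.
- by rewrite prodr_const card_ord.
- by move=> _ z; rewrite mulr_ge0// perturb_lik_ge0.
- by move=> _; apply: measurable_funM; exact: measurable_perturb_lik.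
Qed.

Let integral_sample_lik_sqr j :
  (\int[iid_prob flat_prob n]_s (sample_lik j s * sample_lik j s)%:E <=
   (2 * m%:R ^+ d)%:E)%E.
Proof.
set s := delta ^+ 2 * m%:R^-1 ^+ d.
have us : (\int[cube_prob R d]_x (bump j x ^+ 2)%:E <= s%:E)%E.
  under eq_integral do rewrite exprMn EFinM.
  rewrite ge0_integralZl//; last 3 first.
  - apply/measurable_EFinP; apply: measurable_funX; exact: measurable_tent.
  - by move=> x _; rewrite lee_fin sqr_ge0.
  - by rewrite lee_fin sqr_ge0.
  rewrite [leRHS]EFinM; apply: lee_wpmul2l; first by rewrite lee_fin sqr_ge0.
  exact: integral_tent_sqr.
have := integral_perturb_lik_sqr r0 r1 (half_range_bump j) us.
set I := (\int[_]_z _)%E => Iq.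
have I0 : (0 <= I)%E.
  apply: integral_ge0 => z _.
  by rewrite lee_fin mulr_ge0// perturb_lik_ge0.
have IE : I = (fine I)%:E.
  by rewrite fineK// ge0_fin_numE// (le_lt_trans Iq)// ltry.
rewrite (integral_sample_lik2 IE) lee_fin; apply: le_trans cost.
have s0 : 0 <= s.
  by apply: mulr_ge0; rewrite ?sqr_ge0// exprn_ge0// invr_ge0.
have y0 : 0 <= 4 * r * s.
  by apply: mulr_ge0 => //; apply: mulr_ge0 => //; exact: ltW.
apply: (@le_trans _ _ (expR (4 * r * s) ^+ n)).
  apply: lerXn2r; rewrite ?nnegrE ?expR_ge0 ?fine_ge0//.
  by rewrite -lee_fin -IE (le_trans Iq)// lee_fin expR_ge1Dx.
rewrite -expRM_natl ler_expR.
set mcost := (m%:R `^ (- alpha)) ^+ 2 * m%:R^-1 ^+ d.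
have -> : m%:R `^ (- (2 * alpha + d%:R)) = mcost.
  have mn0 : m%:R != 0 :> R by rewrite pnatr_eq0 -lt0n.
  rewrite opprD powRD; last by rewrite mn0 implybT.
  rewrite -[X in _ = X * _]powR_mulrn ?powR_ge0// -powRrM mulNr mulrC.
  by rewrite !powRN powR_mulrn// exprVn mulrC (mulrC alpha).
have sle : s <= 5^-1 ^+ 2 * mcost.
  rewrite mulrA -exprMn.
  apply: ler_wpM2r; first by rewrite exprn_ge0// invr_ge0.
  apply: lerXn2r => //; rewrite nnegrE; first exact: ltW.
  by apply: mulr_ge0; [rewrite invr_ge0|exact: powR_ge0].
apply: (@le_trans _ _ (n%:R * (4 * r * (5^-1 ^+ 2 * mcost)))).
  by rewrite ler_wpM2l// ler_wpM2l// mulr_ge0// ltW.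
by rewrite le_eqVlt; apply/orP; left; apply/eqP; field.
Qed.

(** If the estimator is far from the flat function at some centre with
    probability above [1 / 8] under the flat law, the flat function is a
    witness. Otherwise, by [mixture_second_moment], it is near the flat function
    at all centres, hence far from a competitor at the centre of its bump, with
    probability at least [1 / 8] under the law of that competitor. *)
Lemma bump_lower_bound
    (etahat : n.-tuple (d.-tuple R * bool) -> d.-tuple R -> R) :
  estimator etahat ->
  exists2 zeta, holder alpha L zeta &
    (8^-1%:E <= sample_prob (fun x => r * zeta x)%R
       [set s | (r * (a * (2 * m%:R) `^ (- alpha)) / 2 <=
                 sup_dist (fun x => r * zeta x) (etahat s))%R])%E.
Proof.
move=> est; have [eta01 meta] := est.
pose tau := r * delta / 2.
pose flat : d.-tuple R -> R := perturb r (cst 0).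
pose A := \bigcup_(j in [set: {ffun 'I_d -> 'I_m}])
  [set s | tau <= `|flat (grid_center j) - etahat s (grid_center j)|].
have mA : measurable A.
  apply: fin_bigcup_measurable => // j _.
  apply: (measurable_deviation _ _ est).
  exact: grid_center_cube.
have [A8|A8] := leP (iid_prob flat_prob n A) 8^-1%:E; last first.
  exists (fun _ : d.-tuple R => 2^-1 + 0) => //.
  rewrite -[X in sample_prob X]/flat.
  rewrite (sample_prob_perturb r0 r1 (@half_range0 R d)).
  apply: (le_trans (ltW A8)); apply: le_mu_ext_measurable => // s [j _] /= h.
  apply: (le_trans h); apply: sup_dist_ge; last exact: grid_center_cube.
    by move=> y _; exact: (perturb01 r0 r1 (@half_range0 R d)).
  by move=> y; exact: eta01.
have [j Qj] : exists j, (iid_prob (bump_prob j) n A <= (7 / 8)%:E)%E.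
  have cardJ : #|{: {ffun 'I_d -> 'I_m}}| = (m ^ d)%N.
    by rewrite card_ffun !card_ord.
  apply: (mixture_second_moment (Lam := sample_lik) _ _ _ _ _ _ mA A8).
  - by rewrite cardJ expn_gt0 m0.
  - by move=> j s; rewrite prodr_ge0// => i _; exact: perturb_lik_ge0.
  - move=> j; apply: (measurable_prod_tnth (g := fun=> lik j)) => _.
    exact: measurable_perturb_lik.
  - move=> j B mB.
    transitivity (\int[iid_prob (bump_prob j) n]_s (\1_B s)%:E)%E.
      by rewrite integral_indic// setIT.
    apply: integral_iid_density.
    + exact: perturb_lik_ge0.
    + exact: measurable_perturb_lik.
    + by move=> h h0 mh; exact: integral_perturb_density.
    + by move=> s; rewrite lee_fin.
    + by apply/measurable_EFinP; exact: measurable_indic.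
  - move=> i j ij; rewrite (@integral_sample_lik2 _ _ 1) ?expr1n//.
    apply: integral_perturb_lik2_disjoint => // x.
    by rewrite /bump mulrACA tent_disjoint// mulr0.
  - by move=> j; rewrite cardJ natrX; exact: integral_sample_lik_sqr.
exists (fun x => 2^-1 + bump j x) => //.
rewrite -[X in sample_prob X]/(perturb r (bump j)).
rewrite (sample_prob_perturb r0 r1 (half_range_bump j)).
apply: (@le_trans _ _ (iid_prob (bump_prob j) n (~` A))).
  rewrite [leRHS]probability_setC//.
  have QjE := fineK (fin_num_measure (iid_prob (bump_prob j) n) A mA).
  by move: Qj; rewrite -QjE -EFinB !lee_fin; lra.
apply: le_mu_ext_measurable; first exact: measurableC.
move=> s /= As.
have cj := @grid_center_cube R d m j.
have dev0 : `|flat (grid_center j) - etahat s (grid_center j)| < tau.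
  by rewrite ltNge; apply/negP => h; apply: As; exists j.
apply: (@le_trans _ _
    `|perturb r (bump j) (grid_center j) - etahat s (grid_center j)|).
  move: dev0; rewrite /flat /perturb /bump tent_center /= /tau addr0 mulr1.
  have rd : 0 < r * delta by rewrite mulr_gt0.
  rewrite mulrDr ltr_norml ler_normr => /andP[h1 h2]; apply/orP; left.
  by rewrite -/delta; lra.
apply: sup_dist_ge => // y _; exact: (perturb01 r0 r1 (half_range_bump j)).
Qed.

End bumps.

Theorem theorem17 (R : realType) (d : nat) (alpha L : R) (hd : (0 < d)%N)
    (halpha0 : 0 < alpha) (halpha1 : alpha <= 1) (hL : 0 < L) :
  exists (n0 : nat) (c : R), 0 < c /\
    forall r : R, 0 < r -> r <= 1 ->
    forall n : nat, (n0 <= n)%N -> 1 <= n%:R * r ->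
    forall etahat : n.-tuple (d.-tuple R * bool) -> d.-tuple R -> R,
      estimator etahat ->
      (8^-1%:E <=
       ereal_sup
         [set sample_prob (fun x => r * zeta x)%R
            [set s |
               (c * (ln (n%:R * r) / n%:R) `^ (alpha / (2 * alpha + d%:R))
                  * r `^ ((alpha + d%:R) / (2 * alpha + d%:R))
                <= sup_dist (fun x => r * zeta x) (etahat s))%R]
         | zeta in holder alpha L])%E.
Proof.
set beta := 2 * alpha + d%:R.
have b0 : 0 < beta by rewrite addr_gt0 ?mulr_gt0 ?ltr0n.
(* the height of the bumps is [a (2 m) ^ (- alpha)] *)
pose a := Num.min L 5^-1.
have a0 : 0 < a by rewrite lt_min hL invr_gt0 ltr0n.
have aL : a <= L by rewrite ge_min lexx.
have a5 : a <= 5^-1 by rewrite ge_min lexx orbT.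
exists 0%N, (a * 4 `^ (- alpha) / 2).
split; first by rewrite divr_gt0// mulr_gt0// powR_gt0.
move=> r r0 r1 n _ N1 etahat est.
have [m [m0 cost rate]] := grid_size hd halpha0 halpha1 N1.
have [zeta zetaH zetaP] :=
  bump_lower_bound halpha0 halpha1 r0 r1 a0 aL a5 m0 cost est.
apply: (le_trans zetaP).
apply: le_trans (ereal_sup_ubound _); last by exists zeta.
apply: le_mu_ext => s /=; apply: le_trans.
have rn0 : n%:R * r != 0 by rewrite gt_eqF// (lt_le_trans ltr01).
have m0' : 0 < m%:R :> R by rewrite ltr0n.
have lnN0 : 0 <= ln (n%:R * r) by rewrite ln_ge0.
have -> : ln (n%:R * r) / n%:R = r * (ln (n%:R * r) / (n%:R * r)).
  by field; rewrite gt_eqF//=; apply: contraNneq rn0 => ->; rewrite mul0r.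
rewrite powRM ?divr_ge0 ?(ltW r0) ?mulr_ge0 ?(ltW r0)//.
(* one power of [r] comes from [1 / n = r / N], the other is explicit *)
have rpow : r `^ (alpha / beta) * r `^ ((alpha + d%:R) / beta) = r.
  rewrite -powRD ?(gt_eqF r0) ?implybT//.
  have -> : alpha / beta + (alpha + d%:R) / beta = 1.
    by rewrite -mulrDl (_ : _ + _ = beta) ?divff ?gt_eqF// /beta; ring.
  by rewrite powRr1// ltW.
set X := (_ / (_ * r)) `^ _.
have -> : a * 4 `^ (- alpha) / 2 * (r `^ (alpha / beta) * X) *
    r `^ ((alpha + d%:R) / beta) = r * a / 2 * (4 `^ (- alpha) * X).
  by rewrite -[in RHS]rpow; ring.
have -> : r * (a * (2 * m%:R) `^ (- alpha)) / 2 =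
    r * a / 2 * (2 * m%:R) `^ (- alpha) by ring.
apply: ler_wpM2l; first by rewrite divr_ge0// mulr_ge0// ltW.
apply: (@le_trans _ _ (4 `^ (- alpha) * (2 / m%:R) `^ alpha)).
  by apply: ler_wpM2l rate; exact: powR_ge0.
rewrite !powRN -[X in _ <= X]mul1r ler_pdivlMr ?powR_gt0 ?mulr_gt0//.
rewrite -mulrA -powRM ?divr_ge0 ?mulr_ge0//.
have -> : 2 / m%:R * (2 * m%:R) = 4 :> R by field; rewrite gt_eqF.
by rewrite mulVf// gt_eqF// powR_gt0.
Qed.
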